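(* Let $V$ be a vector space over a field $\mathbb F$, $\mathcal L$ a series in $V$ and $S(\mathcal L)$ its stabilizer. Then the elements of the Hirsch-Plotkin radical of $S(\mathcal L)$ are unipotent.
   Context: A series in an $\mathbb F$-vector space $V$ is a set $\mathcal L$ of subspaces of $V$, linearly ordered by inclusion, containing $0$ and $V$, such that for every $\mathcal F\subseteq\mathcal L$ both $\bigcap_{W\in\mathcal F}W$ and $\bigcup_{W\in\mathcal F}W$ belong to $\mathcal L$ (with the convention that the empty intersection is $V$ and the empty union is $0$). A jump of $\mathcal L$ is a pair $(B,T)$ of elements of $\mathcal L$ with $B<T$ and no element of $\mathcal L$ strictly between $B$ and $T$. Linear maps act on the right, and $[T,g]=T(g-1)$. The stabilizer (stability group) of $\mathcal L$ is $S(\mathcal L)=\{g\in \mathrm{GL}(V,\mathbb F)\mid [T,g]\le B \text{ for every jump }(B,T)\text{ of }\mathcal L\}$. An element $g\in \mathrm{GL}(V,\mathbb F)$ is unipotent if there is $n\in\mathbb N$ with $(g-1)^n=0$ in $\mathrm{End}_{\mathbb F}(V)$. The Hirsch-Plotkin radical of a group is the subgroup generated by all its locally nilpotent normal subgroups. *)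

(* Defs.v *)
From HB Require Import structures.
From mathcomp Require Import all_boot all_order all_algebra.
From mathcomp Require Import all_classical.

Set Implicit Arguments.
Unset Strict Implicit.
Unset Printing Implicit Defensive.

Import GRing.Theory.

Local Open Scope classical_set_scope.

Section GroupTheory.
Local Open Scope group_scope.
Variable G : groupType.
Implicit Types H N A : set G.

Definition subgroup H : Prop := group_closed [in H].

Definition generated A : set G := smallest subgroup A.

Definition normal_subgroup N H : Prop :=
  [/\ subgroup N, N `<=` H & forall x y, N x -> H y -> N (x ^ y)].

Fixpoint lower_central H (n : nat) : set G :=
  if n is m.+1 then generated [set [~ x, y] | x in lower_central H m & y in H]
  else H.

Definition nilpotent H : Prop := exists n, lower_central H n = [set 1].

Definition locally_nilpotent H : Prop :=
  forall A, finite_set A -> A `<=` H -> nilpotent (generated A).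

Definition hirsch_plotkin H : set G :=
  generated
    (\bigcup_(N in [set N | normal_subgroup N H /\ locally_nilpotent N]) N).

End GroupTheory.

Section GeneralLinearGroup.
Local Open Scope ring_scope.
Variables (F : fieldType) (V : lmodType F).

Record GL := MkGL {
  GL_fun :> V -> V;
  _ : `[< linear GL_fun /\ bijective GL_fun >] }.

HB.instance Definition _ := [isSub for GL_fun].
HB.instance Definition _ := [Choice of GL by <:].

Implicit Types f g h : GL.

Lemma GL_linear g : linear g.
Proof. by case: g => g /= /asboolP[]. Qed.

Lemma GL_bij g : bijective g.
Proof. by case: g => g /= /asboolP[]. Qed.

Lemma GL_one_subproof : `[< linear (@idfun V) /\ bijective (@idfun V) >].
Proof. by apply/asboolP; split => //; exists idfun. Qed.

Definition GL_one : GL := MkGL GL_one_subproof.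

Lemma GL_mul_subproof f g : `[< linear (g \o f) /\ bijective (g \o f) >].
Proof.
apply/asboolP; split; last exact: bij_comp (GL_bij g) (GL_bij f).
by move=> a u v; rewrite /= !GL_linear.
Qed.

(* Linear maps act on the right: v (f g) = (v f) g, so that f is applied
   first in the product f * g. *)
Definition GL_mul f g : GL := MkGL (GL_mul_subproof f g).

Lemma GL_inv_ex g : exists h : GL, cancel g h /\ cancel h g.
Proof.
have [h gK hK] := GL_bij g.
suff Ph : `[< linear h /\ bijective h >] by exists (MkGL Ph).
apply/asboolP; split; last by exists g.
by move=> a u v; rewrite -{1}(hK u) -{1}(hK v) -GL_linear gK.
Qed.

Definition GL_inv g : GL := projT1 (cid (GL_inv_ex g)).

Lemma GL_mulA : associative GL_mul.
Proof. by move=> f g h; apply: val_inj. Qed.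

Lemma GL_mul1 : left_id GL_one GL_mul.
Proof. by move=> g; apply: val_inj. Qed.

Lemma GL_1mul : right_id GL_one GL_mul.
Proof. by move=> g; apply: val_inj. Qed.

Lemma GL_mulV : left_inverse GL_one GL_inv GL_mul.
Proof.
move=> g; apply: val_inj; apply/funext => v /=.
by rewrite /GL_inv; case: cid => h /= [].
Qed.

Lemma GL_Vmul : right_inverse GL_one GL_inv GL_mul.
Proof.
move=> g; apply: val_inj; apply/funext => v /=.
by rewrite /GL_inv; case: cid => h /= [].
Qed.

HB.instance Definition _ :=
  isGroup.Build GL GL_mulA GL_mul1 GL_1mul GL_mulV GL_Vmul.

(* the subspace [T, g] = T (g - 1) *)
Definition commutator_space (T : set V) g : set V := [set g v - v | v in T].

Definition unipotent g : Prop :=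
  exists n : nat, iter n (fun v => g v - v) =1 (fun=> 0).

Definition subspace (W : set V) : Prop := submod_closed [in W].

(* The library's empty intersection is [setT], as required, but its empty union
   is [set0] rather than the zero subspace: hence the nonemptiness condition in
   the last clause, the case of the empty family being the clause
   [L [set 0]]. *)
Definition is_series (L : set (set V)) : Prop :=
  [/\ L `<=` subspace,
      forall W U, L W -> L U -> W `<=` U \/ U `<=` W,
      L [set 0] /\ L setT,
      forall E, E `<=` L -> L (\bigcap_(W in E) W)
    & forall E, E `<=` L -> E !=set0 -> L (\bigcup_(W in E) W)].

Definition jump (L : set (set V)) (B T : set V) : Prop :=
  [/\ L B, L T, B `<` T & forall W, L W -> ~ (B `<` W /\ W `<` T)].

Definition stability_group (L : set (set V)) : set GL :=
  [set g | forall B T, jump L B T -> commutator_space T g `<=` B].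

End GeneralLinearGroup.

(* Main.v *)
Require Import Defs.
From HB Require Import structures.
From mathcomp Require Import all_boot all_algebra all_classical.

(** Write [S] for the stabilizer of the series, [d v = g v - v], and let [g] lie
    in the Hirsch-Plotkin radical of [S].

    By the Hirsch-Plotkin theorem ([hirsch_plotkin_product]) a product of two
    locally nilpotent normal subgroups is again one, so [g] lies in a single
    such subgroup and is a left Engel element of [S]: for every [x] in [S] some
    iterated commutator [[x, g, ..., g]] is trivial ([hirsch_plotkin_engel]).
    The rest of the proof is linear algebra and uses this property only: if [d]
    were not nilpotent, some [x] in [S] would violate it.

    The elements [x] that are tested have the form [1 + phi], where [phi] sends
    the top of every jump into its bottom and [phi h phi = 0] for every [h] in
    [S] that commutes with [g].  Then the conjugates of [x] by powers of [g]
    commute, and the [n]-th iterated commutator is trivial exactly when the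
    [n]-th iterate of [phi |-> d phi - phi d] kills [phi] ([engel_iter_ad]).

    A first choice is the rank one map [phi v = f v *: u], where [u] lies in a
    proper member [W] of the series and the functional [f] vanishes on [W].  The
    Engel condition gives a monic polynomial in [d] that kills [u], and as [d]
    moves every nonzero vector strictly down the series, this forces [d] to be
    nilpotent on [u].  Hence [d] is locally nilpotent on the whole space
    ([delta_locally_nilpotent]): [V] is the union of the kernels [K m] of the
    powers [d ^ m].

    This makes infinite sums [phi = f_0 u_0 + f_1 u_1 + ...] available: they are
    locally finite as soon as [f_k] vanishes on [K m_k] for an increasing
    sequence [m_k].  If moreover [f_k] vanishes on a member [W_k] of the series
    that contains [u_k], with [W_k] decreasing, and [K m_k] contains all the
    earlier [u_j], then [phi] has the properties asked above
    ([refinement_contradiction]).  The [k]-th term is chosen to make the iterate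
    of order [m_k] nonzero at some vector, where the later terms vanish.  Such
    terms exist if [d] is not nilpotent modulo some nonzero [W] in the series,
    with [W_k = W] constant ([unipotent_quotient]).  Otherwise [d] is nilpotent
    modulo every nonzero [W], hence not nilpotent on any of them if it is not
    nilpotent on [V], and suitable [W_k] decrease to zero
    ([unipotent_of_engel]). *)

Set Implicit Arguments.
Unset Strict Implicit.
Unset Printing Implicit Defensive.

Import GRing.Theory.

(** * Locally nilpotent normal subgroups *)

Section HirschPlotkin.
Local Open Scope classical_set_scope.
Local Open Scope group_scope.
Variable G : groupType.
Implicit Types (H N M A B X Y : set G) (x y z : G).

Lemma subgroupP H : subgroup H <->
  [/\ H 1, (forall x y, H x -> H y -> H (x * y)) & forall x, H x -> H x^-1].
Proof.
split=> [[H1 HB]|[H1 HM HV]].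
  have {}HB x y : H x -> H y -> H (x / y).
    by move=> Hx Hy; apply/set_mem/HB; exact/mem_set.
  have HV x : H x -> H x^-1.
    by move=> Hx; rewrite -div1g; apply: HB => //; apply/set_mem.
  split=> [|x y Hx Hy|]; [exact/set_mem| |exact: HV].
  by rewrite -[y]invgK; apply: HB => //; apply: HV.
split; first exact/mem_set.
by move=> x y /set_mem Hx /set_mem Hy; apply/mem_set/HM => //; apply: HV.
Qed.

Lemma subgroup1 H : subgroup H -> H 1.
Proof. by case/subgroupP. Qed.

Lemma subgroupM H x y : subgroup H -> H x -> H y -> H (x * y).
Proof. by case/subgroupP => _ + _; apply. Qed.

Lemma subgroupV H x : subgroup H -> H x -> H x^-1.
Proof. by case/subgroupP => _ _; apply. Qed.

Lemma subgroupJ H x y : subgroup H -> H x -> H y -> H (x ^ y).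
Proof.
by move=> sH Hx Hy; rewrite conjgE; do 2?apply: subgroupM => //; apply: subgroupV.
Qed.

Lemma subgroupR H x y : subgroup H -> H x -> H y -> H [~ x, y].
Proof.
move=> sH Hx Hy; rewrite commgEl.
exact: subgroupM (subgroupV sH Hx) (subgroupJ sH Hx Hy).
Qed.

Lemma subgroup_conj_preimage H y : subgroup H -> subgroup [set x | H (x ^ y)].
Proof.
move=> sH; apply/subgroupP; split=> /= [|u v|u].
- by rewrite conj1g; exact: subgroup1.
- by rewrite conjMg; exact: subgroupM.
- by rewrite conjVg; exact: subgroupV.
Qed.

Lemma generated_subgroup A : subgroup (generated A).
Proof.
apply/subgroupP; split=> [|x y Ax Ay|x Ax] H [sH AH].
- exact: subgroup1.
- by apply: subgroupM => //; [apply: Ax|apply: Ay].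
- by apply: subgroupV => //; apply: Ax.
Qed.

Lemma generated_min A H : subgroup H -> A `<=` H -> generated A `<=` H.
Proof. exact: smallest_sub. Qed.

Lemma sub_generated A : A `<=` generated A.
Proof. exact: sub_gen_smallest. Qed.

Lemma generatedS A B : A `<=` generated B -> generated A `<=` generated B.
Proof. by move=> AB; apply: generated_min => //; exact: generated_subgroup. Qed.

Hint Resolve generated_subgroup : core.

Lemma commg_conj x y : x ^ y = x * [~ x, y].
Proof. by rewrite commgEl mulVKg. Qed.

Definition normalises (J H : set G) := forall x y, H x -> J y -> H (x ^ y).

Lemma normalises_generators A J : (forall x, J x -> J x^-1) ->
  (forall x y, A x -> J y -> generated A (x ^ y)) ->
  normalises (generated J) (generated A).
Proof.
move=> JV AJ.
have gAJ x y : J y -> generated A x -> generated A (x ^ y).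
  move=> Jy; apply: (generated_min (H := [set x | generated A (x ^ y)])).
    exact: subgroup_conj_preimage.
  by move=> u Au; apply: AJ.
move=> x y + Jy; move: y Jy x.
(* closure under inverses has to be carried along in the induction *)
pose K := [set y | forall x, generated A x -> generated A (x ^ y)].
suff sK : subgroup [set y | K y /\ K y^-1].
  move=> y Jy; have [] // : [set y | K y /\ K y^-1] y.
  apply: generated_min Jy => // u Ju; split=> x; apply: gAJ => //.
  exact: JV.
apply/subgroupP; split=> /=.
- by rewrite invg1; split=> x; rewrite conjg1.
- move=> u v [Ku Ku'] [Kv Kv']; rewrite invgM; split=> x Ax; rewrite conjgM.
    by apply: Kv; exact: Ku.
  by apply: Ku'; exact: Kv'.
- by move=> u [Ku Ku']; rewrite invgK.
Qed.

Lemma lower_central_subgroup H n : subgroup H -> subgroup (lower_central H n).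
Proof. by case: n => //= n _. Qed.

Lemma lower_centralS H K n : H `<=` K -> lower_central H n `<=` lower_central K n.
Proof.
move=> HK; elim: n => //= n IH; apply: generatedS => _ [x Hx [y Hy <-]].
by apply: sub_generated; exists x; [exact: IH|exists y => //; exact: HK].
Qed.

Lemma lower_centralR H n x y : lower_central H n x -> H y ->
  lower_central H n.+1 [~ x, y].
Proof. by move=> Hx Hy; apply: sub_generated; exists x => //; exists y. Qed.

Lemma lower_central_normalises H J n : subgroup H ->
  normalises J H -> normalises J (lower_central H n).
Proof.
move=> sH nH; elim: n => //= n IH x y + Jy.
apply: (generated_min (H := [set x | lower_central H n.+1 (x ^ y)])).
  by apply: subgroup_conj_preimage; exact: (lower_central_subgroup n.+1).
move=> _ [u Hu [v Hv <-]] /=; rewrite conjRg.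
by apply: sub_generated; exists (u ^ y); [exact: IH|exists (v ^ y) => //; exact: nH].
Qed.

Lemma lower_central_le H n : subgroup H ->
  lower_central H n.+1 `<=` lower_central H n.
Proof.
move=> sH; apply: generated_min; first exact: lower_central_subgroup.
move=> _ [u Hu [v Hv <-]]; rewrite commgEl.
have sn := lower_central_subgroup n sH.
apply: subgroupM sn (subgroupV sn Hu) _.
apply: (lower_central_normalises (J := H)) => //.
by move=> *; apply: subgroupJ.
Qed.

Lemma lower_central_anti H m n : subgroup H -> (m <= n)%N ->
  lower_central H n `<=` lower_central H m.
Proof.
move=> sH; elim: n => [|n IH]; first by rewrite leqn0 => /eqP->.
rewrite leq_eqVlt => /orP[/eqP-> //|/IH le u /(lower_central_le sH)].
exact: le.
Qed.

Lemma lower_central_sub H n : subgroup H -> lower_central H n `<=` H.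
Proof. by move=> sH; exact: (lower_central_anti (m := 0)). Qed.

Lemma nilpotentS H K : subgroup H -> H `<=` K -> nilpotent K -> nilpotent H.
Proof.
move=> sH HK [n Kn]; exists n; apply/seteqP; split.
  by rewrite -Kn; apply: lower_centralS.
by move=> _ ->; apply: subgroup1; exact: lower_central_subgroup.
Qed.

Lemma central_series_nilpotent J (D : nat -> set G) n : subgroup J ->
  J `<=` D 0%N -> (forall i, subgroup (D i)) ->
  (forall i x y, D i x -> J y -> D i.+1 [~ x, y]) -> D n `<=` [set 1] -> nilpotent J.
Proof.
move=> sJ J0 sD RD Dn; exists n; apply/seteqP; split; last first.
  by move=> _ ->; apply: subgroup1; exact: lower_central_subgroup.
apply: subset_trans Dn; elim: n => //= i IH.
by apply: generated_min => // _ [u Hu [v Hv <-]]; apply: RD => //; exact: IH.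
Qed.

Lemma subgroup_commutes_left D J : subgroup D -> subgroup J ->
  normalises J D -> subgroup [set x | J x /\ forall y, J y -> D [~ x, y]].
Proof.
move=> sD sJ nD; apply/subgroupP; split=> /=.
- by split=> [|y _]; rewrite ?comm1g; exact: subgroup1.
- move=> u v [Ju Du] [Jv Dv]; split=> [|y Jy]; first exact: subgroupM.
  have -> : [~ u * v, y] = [~ u, y] ^ v * [~ v, y].
    by rewrite !commgEl !conjgE !invgM !mulgA ?mulgK ?mulgVK.
  by apply: subgroupM => //; [apply: nD => //; exact: Du|exact: Dv].
- move=> u [Ju Du]; split=> [|y Jy]; first exact: subgroupV.
  have -> : [~ u^-1, y] = ([~ u, y] ^ u^-1)^-1.
    by rewrite !commgEl !conjgE !invgM !invgK !mulgA ?mulgK ?mulgVK.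
  by apply: subgroupV => //; apply: nD; [exact: Du|exact: subgroupV].
Qed.

Lemma subgroup_commutes_right D J x : subgroup D -> subgroup J ->
  normalises J D -> subgroup [set y | J y /\ D [~ x, y]].
Proof.
move=> sD sJ nD; apply/subgroupP; split=> /=.
- by split; rewrite ?commg1; exact: subgroup1.
- move=> u v [Ju Du] [Jv Dv]; split; first exact: subgroupM.
  have -> : [~ x, u * v] = [~ x, v] * [~ x, u] ^ v.
    by rewrite !commgEl !conjgE !invgM !mulgA !mulgK.
  by apply: subgroupM => //; exact: nD Du Jv.
- move=> u [Ju Du]; split; first exact: subgroupV.
  have -> : [~ x, u^-1] = ([~ x, u] ^ u^-1)^-1.
    by rewrite !commgEl !conjgE !invgM !invgK !mulgA ?mulgK ?mulgVK ?mulgV ?mul1g.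
  by apply: subgroupV => //; apply: nD => //; exact: subgroupV.
Qed.

(** The lower central series of [A] shifted by one step, with [J] put in front,
    so that taking commutators with [A] always goes one step down. *)
Definition lower_central_from J A i := if i is j.+1 then lower_central A j else J.

(** Fitting's theorem. With [A_i] the shifted series above, the subgroups
    generated by the intersections of [A_p] and [B_q] for [p + q = n] form a
    central series of [J]: a commutator with an element of [A] raises [p], one
    with an element of [B] raises [q], and normality keeps the other index. *)
Lemma fitting J A B : subgroup J -> subgroup A -> subgroup B ->
  A `<=` J -> B `<=` J -> normalises J A -> normalises J B ->
  J `<=` generated (A `|` B) -> nilpotent A -> nilpotent B -> nilpotent J.
Proof.
move=> sJ sA sB AJ BJ nA nB JAB [a Aa] [b Bb].
pose gam A i := lower_central_from J A i.
have sg K i : subgroup K -> subgroup (gam K i).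
  by case: i => //= i sK; exact: lower_central_subgroup.
have gJ K i : subgroup K -> K `<=` J -> gam K i `<=` J.
  case: i => [|i] sK KJ x //= /(lower_central_sub sK); exact: KJ.
have ng K i : subgroup K -> normalises J K -> normalises J (gam K i).
  case: i => [|i] sK nK; last exact: lower_central_normalises.
  by move=> u v; exact: subgroupJ.
have gR K i u v : subgroup K -> normalises J K -> gam K i u -> K v ->
    gam K i.+1 [~ u, v].
  case: i => [|i] sK nK /= Ku Kv; last exact: lower_centralR.
  rewrite -invgR; apply: subgroupV => //; rewrite commgEl.
  by apply: subgroupM => //; [exact: subgroupV|exact: nK].
pose E n := \bigcup_(p in [set p : nat * nat | (p.1 + p.2)%N = n])
   (gam A p.1 `&` gam B p.2).
have nE n : normalises J (generated (E n)).
  move=> x y + Jy.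
  apply: (generated_min (H := [set x | generated (E n) (x ^ y)])).
    exact: subgroup_conj_preimage.
  move=> u [p pn [Au Bu]] /=; apply: sub_generated; exists p => //.
  by split; apply: ng.
apply: (@central_series_nilpotent J (fun n => generated (E n)) (a + b).+1) => //.
- by move=> x Jx; apply: sub_generated; exists (0, 0)%N.
- move=> i x y Ex Jy.
  suff: [set x | J x /\ forall y, J y -> generated (E i.+1) [~ x, y]] x.
    by case=> _; apply.
  apply: generated_min Ex; first exact: subgroup_commutes_left.
  move=> u [[p q] /= pq [Au Bu]]; split=> [|z Jz]; first exact: (gJ A p).
  suff [] : [set y | J y /\ generated (E i.+1) [~ u, y]] z by [].
  apply: generated_min (JAB _ Jz); first exact: subgroup_commutes_right.
  have RK K r v : subgroup K -> K `<=` J -> normalises J K ->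
      J v -> gam K r u -> gam K r [~ u, v].
    move=> sK KJ nK Jv Ku; rewrite commgEl; apply: (subgroupM (sg _ _ sK)).
      by apply: subgroupV => //; exact: sg.
    exact: ng.
  move=> v [Av|Bv]; split; rewrite /= ?(AJ v) ?(BJ v) //.
  + by apply: AJ.
  + apply: sub_generated; exists (p.+1, q) => /=; first by rewrite addSn pq.
    by split; [exact: gR|apply: RK => //; exact: AJ].
  + by apply: BJ.
  + apply: sub_generated; exists (p, q.+1) => /=; first by rewrite addnS pq.
    by split; [apply: RK => //; exact: BJ|exact: gR].
- apply: generated_min; first by rewrite -Aa; exact: lower_central_subgroup.
  move=> x [[p q] /= pq [Ap Bq]].
  (* [p + q = a + b + 1] forces [p > a] or [q > b] *)
  have [ap|pa] := ltnP a p.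
    case: p ap {pq} Ap => // p ap /= Ap.
    by have := lower_central_anti (n := p) sA ap Ap; rewrite Aa.
  have : (b < q)%N by rewrite -(ltn_add2l p) pq ltnS leq_add2r.
  case: q {pq} Bq => // q Bq bq.
  by have := lower_central_anti (n := q) sB bq Bq; rewrite Bb.
Qed.

Lemma normal_subgroupR N H x y : subgroup H -> normal_subgroup N H ->
  H x -> N y -> N [~ x, y].
Proof.
move=> sH [sN NH nN] Hx Ny; rewrite -invgR; apply: subgroupV => //; rewrite commgEl.
by apply: subgroupM => //; [exact: subgroupV|exact: nN].
Qed.

(** The commutators [[y, x_1]] lie in [N], so together with [X] they generate a
    nilpotent group, in which [[y, x_1, ..., x_j]] is trivial for large [j]:
    finitely many iterated commutators suffice. As [y ^ x = y [y, x]], the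
    subgroup generated by [Z] is invariant under conjugation by [X]. *)
Lemma finite_commutator_closure H N X Y : subgroup H ->
  normal_subgroup N H -> locally_nilpotent N ->
  finite_set X -> X `<=` N -> finite_set Y -> Y `<=` H ->
  exists Z, [/\ finite_set Z, Y `<=` Z,
    forall z x, Z z -> X x -> Z [~ z, x] &
    forall K, subgroup K -> Y `<=` K ->
      (forall k x, K k -> X x -> K [~ k, x]) -> Z `<=` K].
Proof.
move=> sH nN lN fX XN fY YH; have [sN NH _] := nN.
pose step A := [set [~ z, x] | z in A & x in X].
pose W i := iter i step Y.
have fW i : finite_set (W i) by elim: i => //= i IH; exact: finite_image2.
have [n Wn] : exists n, W n.+1 `<=` [set 1].
  have XWN : X `|` W 1%N `<=` N.
    move=> x [/XN //|[y Yy [z Xz <-]]].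
    by apply: (normal_subgroupR sH nN); [exact: YH|exact: XN].
  have [|n nn] := lN _ _ XWN; first by rewrite finite_setU.
  exists n; rewrite -nn; elim: n {nn} => [|n IH].
      by move=> x Wx; apply: sub_generated; right.
    move=> _ [z Wz [x Xx <-]]; apply: lower_centralR; first exact: IH.
    by apply: sub_generated; left.
exists ([set 1] `|` \bigcup_(i in `I_n.+1) W i); split.
- rewrite finite_setU; split=> //; exact: bigcup_finite.
- by move=> y Yy; right; exists 0%N.
- move=> z x [->|[i /= ni Wi]] Xx; first by rewrite comm1g; left.
  have Wx : W i.+1 [~ z, x] by exists z => //; exists x.
  move: ni; rewrite ltnS leq_eqVlt => /orP[/eqP|] ni; last by right; exists i.+1.
  by left; apply: Wn; rewrite -ni.
- move=> K sK YK KR x [->|[i _]]; first exact: subgroup1.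
  elim: i x => //= i IH _ [z Wz [x Xx <-]]; apply: KR => //; exact: IH.
Qed.

Definition mulset N M := [set x * y | x in N & y in M].

Lemma normal_mulset H N M : subgroup H ->
  normal_subgroup N H -> normal_subgroup M H -> normal_subgroup (mulset N M) H.
Proof.
move=> sH [sN NH nN] [sM MH nM]; split.
- apply/subgroupP; split=> /=.
  + exists 1; first exact: subgroup1.
    by exists 1; [exact: subgroup1|rewrite mulg1].
  + move=> _ _ [x Nx [y My <-]] [z Nz [t Mt <-]].
    exists (x * z); first exact: subgroupM.
    exists (y ^ z * t); first by apply: subgroupM => //; apply: nM => //; exact: NH.
    by rewrite !conjgE !mulgA mulgK.
  + move=> _ [x Nx [y My <-]].
    exists x^-1; first exact: subgroupV.
    exists (y^-1 ^ x^-1); last by rewrite conjgE invgM invgK !mulgA mulVg mul1g.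
    by apply: nM; [exact: subgroupV|apply: NH; exact: subgroupV].
- by move=> _ [x Nx [y My <-]]; apply: subgroupM => //; [exact: NH|exact: MH].
- move=> _ z [x Nx [y My <-]] Hz; rewrite conjMg.
  by exists (x ^ z); [exact: nN|exists (y ^ z) => //; exact: nM].
Qed.

Lemma finite_symmetric_closure A N : subgroup N -> finite_set A -> A `<=` N ->
  exists X, [/\ finite_set X, A `<=` X, X `<=` N & forall x, X x -> X x^-1].
Proof.
move=> sN fA AN; exists (A `|` [set x^-1 | x in A]); split.
- by rewrite finite_setU; split=> //; exact: finite_image.
- by move=> x Ax; left.
- by move=> _ [/AN //|[x Ax <-]]; apply: subgroupV => //; exact: AN.
- by move=> x [Ax|[y Ay <-]]; [right; exists x|left; rewrite invgK].
Qed.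

Lemma mulset_finite_cover N M A : finite_set A -> A `<=` mulset N M ->
  exists X Y, [/\ finite_set X, X `<=` N, finite_set Y, Y `<=` M &
    forall z, A z -> exists x y, [/\ X x, Y y & z = x * y]].
Proof.
move=> fA AZ.
have /choice[f fP] z : exists p : G * G, A z -> [/\ N p.1, M p.2 & z = p.1 * p.2].
  case: (pselect (A z)) => [/AZ[x Nx [y My <-]]|nAz]; first by exists (x, y).
  by exists (1, 1).
exists [set (f z).1 | z in A], [set (f z).2 | z in A]; split.
- exact: finite_image.
- by move=> _ [z /fP[? ? ?] <-].
- exact: finite_image.
- by move=> _ [z /fP[? ? ?] <-].
- move=> z Az; exists (f z).1, (f z).2.
  by split; [exists z|exists z|case: (fP z Az)].
Qed.

(** A finite subset of [N M] lies in the group [J] generated by finite symmetric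
    subsets [X] of [N] and [Y] of [M]. The commutators [[y, x]] lie in both [N]
    and [M]; closing them under commutators first with [X], then with [Y], gives
    a finite subset [D1] of [N] and [M]. The group [D] generated by [D1] is
    normalised by [X] and [Y] and contains all [[y, x]], so the groups generated
    by [X] and [D1], and by [Y] and [D1], are normal in [J]. They are nilpotent,
    and Fitting's theorem applies. *)
Theorem hirsch_plotkin_product H N M : subgroup H ->
  normal_subgroup N H -> locally_nilpotent N ->
  normal_subgroup M H -> locally_nilpotent M -> locally_nilpotent (mulset N M).
Proof.
move=> sH nN lN nM lM A fA /(mulset_finite_cover fA)[X0 [Y0 [fX0 X0N fY0 Y0M AXY]]].
have [sN NH NJ] := nN; have [sM MH MJ] := nM.
have [X [fX X0X XN XV]] := finite_symmetric_closure sN fX0 X0N.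
have [Y [fY Y0Y YM YV]] := finite_symmetric_closure sM fY0 Y0M.
pose C := [set [~ y, x] | y in Y & x in X].
have fC : finite_set C by exact: finite_image2.
have CN : C `<=` N.
  move=> _ [y Yy [x Xx <-]].
  by apply: (normal_subgroupR sH nN); [exact/MH/YM|exact: XN].
have CM : C `<=` M.
  move=> _ [y Yy [x Xx <-]]; rewrite -invgR; apply: subgroupV => //.
  by apply: (normal_subgroupR sH nM); [exact/NH/XN|exact: YM].
have CH : C `<=` H by move=> c /CN/NH.
have [C1 [fC1 CC1 C1X C1min]] := finite_commutator_closure sH nN lN fX XN fC CH.
have C1N : C1 `<=` N.
  by apply: C1min => // k x Nk Xx; apply: subgroupR => //; exact: XN.
have C1M : C1 `<=` M.
  apply: C1min => // k x Mk Xx; rewrite -invgR; apply: subgroupV => //.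
  by apply: (normal_subgroupR sH nM) => //; exact/NH/XN.
have C1H : C1 `<=` H by move=> c /C1N/NH.
have [D1 [fD1 C1D1 D1Y D1min]] := finite_commutator_closure sH nM lM fY YM fC1 C1H.
have D1N : D1 `<=` N.
  apply: D1min => // k x Mk Xx; rewrite -invgR; apply: subgroupV => //.
  by apply: (normal_subgroupR sH nN) => //; exact/MH/YM.
have D1M : D1 `<=` M.
  by apply: D1min => // k x Nk Xx; apply: subgroupR => //; exact: YM.
pose D := generated D1; have sD : subgroup D by exact: generated_subgroup.
have D1D : D1 `<=` D by exact: sub_generated.
have nDY : normalises (generated Y) D.
  apply: normalises_generators => // x y Dx Yy; rewrite commg_conj.
  by apply: (subgroupM sD); apply: D1D => //; exact: D1Y.
have YR x y : X x -> Y y -> D [~ y, x].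
  move=> Xx Yy; suff Cyx : C [~ y, x] by exact: D1D (C1D1 _ (CC1 _ Cyx)).
  by exists y => //; exists x.
have D1X d x : D1 d -> X x -> D (d ^ x).
  move=> + Xx.
  (* [D] was closed under [X] before its closure under [Y]; that the latter
     keeps the former follows from [y ^ z = y [y, z]] with [[y, z]] in [D] *)
  pose T := [set d | D d /\ forall x, X x -> D (d ^ x)].
  suff D1T : D1 `<=` T by move=> /D1T[_]; apply.
  have sT : subgroup T.
    apply/subgroupP; split=> /= [|u v [Du Tu] [Dv Tv]|u [Du Tu]].
    - by split=> [|z Xz]; rewrite ?conj1g; exact: subgroup1.
    - split=> [|z Xz]; first exact: (subgroupM sD).
      by rewrite conjMg; apply: (subgroupM sD); [exact: Tu|exact: Tv].
    - split=> [|z Xz]; first exact: (subgroupV sD).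
      by rewrite conjVg; apply: (subgroupV sD); exact: Tu.
  apply: D1min => // [c C1c|k y [Dk Tk] Yy].
    split=> [|z Xz]; first exact: D1D (C1D1 _ C1c).
    rewrite commg_conj; apply: (subgroupM sD); first exact: D1D (C1D1 _ C1c).
    exact: D1D (C1D1 _ (C1X _ _ C1c Xz)).
  have gYy : generated Y y by exact: sub_generated.
  have Dky : D (k ^ y) by exact: nDY.
  split=> [|z Xz].
    by rewrite commgEl; apply: (subgroupM sD) => //; exact: (subgroupV sD).
  rewrite conjRg commgEl; apply: (subgroupM sD).
    by apply: (subgroupV sD); exact: Tk.
  rewrite [y ^ z]commg_conj conjgM; apply: (subgroupJ sD); last exact: YR.
  by apply: nDY => //; exact: Tk.
pose J := generated (X `|` Y `|` D1).
pose A1 := generated (X `|` D1); pose B1 := generated (Y `|` D1).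
have sJ : subgroup J by exact: generated_subgroup.
have sA : subgroup A1 by exact: generated_subgroup.
have sB : subgroup B1 by exact: generated_subgroup.
have DA : D `<=` A1 by apply: generatedS => d Dd; apply: sub_generated; right.
have DB : D `<=` B1 by apply: generatedS => d Dd; apply: sub_generated; right.
have JV x : (X `|` Y `|` (D1 `|` [set d^-1 | d in D1])) x ->
     (X `|` Y `|` (D1 `|` [set d^-1 | d in D1])) x^-1.
  move=> [[/XV|/YV]|[d|[d Dd <-]]]; first by left; left.
  - by left; right.
  - by right; right; exists x.
  - by right; left; rewrite invgK.
have JE : J = generated (X `|` Y `|` (D1 `|` [set d^-1 | d in D1])).
  apply/seteqP; split; apply: generatedS => x [XYx|].
  - by apply: sub_generated; left.
  - by move=> Dx; apply: sub_generated; right; left.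
  - by apply: sub_generated; left.
  - case=> [Dx|[d Dd <-]]; first by apply: sub_generated; right.
    by apply: (subgroupV (generated_subgroup _)) => //; apply: sub_generated; right.
have nA : normalises J A1.
  rewrite JE; apply: normalises_generators => // x z.
  have XA u : X u -> A1 u by move=> Xu; apply: sub_generated; left.
  have DA1 u : D1 u -> A1 u by move=> Xu; apply: sub_generated; right.
  move=> XDx [[Xz|Yz]|Dz].
  - by apply: (subgroupJ sA) => //; [exact: sub_generated|exact: XA].
  - case: XDx => [Xx|Dx]; rewrite commg_conj; last first.
      apply: DA; rewrite -commg_conj.
      by apply: nDY; [exact: D1D|exact: sub_generated].
    apply: (subgroupM sA) => //; first exact: XA.
    by rewrite -invgR; apply: (subgroupV sA) => //; apply: DA; exact: YR.
  - apply: (subgroupJ sA) => //; first exact: sub_generated.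
    by case: Dz => [/DA1 //|[d Dd <-]]; apply: (subgroupV sA) => //; exact: DA1.
have nB : normalises J B1.
  rewrite JE; apply: normalises_generators => // x z.
  have YB u : Y u -> B1 u by move=> Xu; apply: sub_generated; left.
  have DB1 u : D1 u -> B1 u by move=> Xu; apply: sub_generated; right.
  move=> YDx [[Xz|Yz]|Dz].
  - case: YDx => [Yx|Dx]; last by apply: DB; exact: D1X.
    rewrite commg_conj; apply: (subgroupM sB) => //; first exact: YB.
    by apply: DB; exact: YR.
  - by apply: (subgroupJ sB) => //; [exact: sub_generated|exact: YB].
  - apply: (subgroupJ sB) => //; first exact: sub_generated.
    by case: Dz => [/DB1 //|[d Dd <-]]; apply: (subgroupV sB) => //; exact: DB1.
apply: (@nilpotentS _ J) => //.
  apply: generatedS => z /AXY[x [y [/X0X Xx /Y0Y Yy ->]]].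
  by apply: (subgroupM sJ) => //; apply: sub_generated; left; [left|right].
apply: (@fitting J A1 B1) => //.
- apply: generatedS => x [Xx|Dx]; apply: sub_generated; first by left; left.
  by right.
- apply: generatedS => x [Xx|Dx]; apply: sub_generated; first by left; right.
  by right.
- apply: generatedS => x [[Xx|Yx]|Dx]; apply: sub_generated.
  + by left; apply: sub_generated; left.
  + by right; apply: sub_generated; left.
  + by left; apply: sub_generated; right.
- by apply: lN; [rewrite finite_setU|move=> x [/XN|/D1N]].
- by apply: lM; [rewrite finite_setU|move=> x [/YM|/D1M]].
Qed.

(** Products of two locally nilpotent normal subgroups being of the same kind,
    their union is already a subgroup. *)
Lemma hirsch_plotkin_single H g : subgroup H -> hirsch_plotkin H g ->
  exists N, [/\ normal_subgroup N H, locally_nilpotent N & N g].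
Proof.
move=> sH; apply: (generated_min
  (H := [set g | exists N, [/\ normal_subgroup N H, locally_nilpotent N & N g]])).
  apply/subgroupP; split=> /=.
  - exists [set 1]; split=> //.
      split=> [|_ ->|_ y -> _]; [|exact: subgroup1|by rewrite conj1g].
      by apply/subgroupP; split=> [//|_ _ -> ->|_ ->]; rewrite ?mulg1 ?invg1.
    move=> A _ A1; exists 0%N; apply/seteqP; split=> /=; last first.
      by move=> _ ->; apply: subgroup1; exact: generated_subgroup.
    apply: generated_min => //.
    by apply/subgroupP; split=> [//|_ _ -> ->|_ ->]; rewrite ?mulg1 ?invg1.
  - move=> x y [N [nN lN Nx]] [M [nM lM My]]; exists (mulset N M); split.
    + exact: normal_mulset.
    + exact: (hirsch_plotkin_product sH).
    + by exists x => //; exists y.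
  - move=> x [N [nN lN Nx]]; exists N; split=> //.
    by case: nN => sN _ _; exact: subgroupV.
by move=> x [N [nN lN] Nx]; exists N.
Qed.

(** [[x, g]] lies in the locally nilpotent normal subgroup that contains [g], and
    together with [g] generates a nilpotent group. *)
Lemma hirsch_plotkin_engel H g x : subgroup H -> hirsch_plotkin H g -> H x ->
  exists n, iter n (fun y => [~ y, g]) x = 1.
Proof.
move=> sH /(hirsch_plotkin_single sH)[N [nN lN Ng]] Hx.
have Nxg : N [~ x, g] by exact: normal_subgroupR nN _ _.
have [|y [->|->] //|n En] := lN [set g; [~ x, g]]; first exact: finite_set2.
exists n.+1; suff: [set (1 : G)] (iter n.+1 (fun y => [~ y, g]) x) by [].
rewrite -En; elim: n {En} => [|n IH].
  by apply: sub_generated; right.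
by rewrite iterS; apply: lower_centralR IH _; apply: sub_generated; left.
Qed.

End HirschPlotkin.

(** * Subspaces and linear functionals *)

Section Subspaces.
Local Open Scope classical_set_scope.
Local Open Scope ring_scope.
Variables (F : fieldType) (V : lmodType F).
Implicit Types (W U : set V) (u v w : V) (a : F).

Lemma subspaceP W : subspace W <->
  [/\ W 0, forall u v, W u -> W v -> W (u + v) & forall a u, W u -> W (a *: u)].
Proof.
split=> [[W0 WL]|[W0 WD WZ]].
  have WL' a u v : W u -> W v -> W (a *: u + v).
    by move=> Wu Wv; apply/set_mem/WL; exact/mem_set.
  split=> [|u v Wu Wv|a u Wu]; first exact/set_mem.
    by rewrite -[u]scale1r; exact: WL'.
  by rewrite -[_ *: _]addr0; apply: WL' => //; exact/set_mem.
split; first exact/mem_set.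
by move=> a u v /set_mem Wu /set_mem Wv; apply/mem_set/WD => //; exact: WZ.
Qed.

Lemma subspace0 W : subspace W -> W 0. Proof. by case/subspaceP. Qed.

Lemma subspaceD W u v : subspace W -> W u -> W v -> W (u + v).
Proof. by case/subspaceP => _ + _; apply. Qed.

Lemma subspaceZ W a u : subspace W -> W u -> W (a *: u).
Proof. by case/subspaceP => _ _; apply. Qed.

Lemma subspaceN W u : subspace W -> W u -> W (- u).
Proof. by move=> sW Wu; rewrite -scaleN1r; exact: subspaceZ. Qed.

Lemma subspaceB W u v : subspace W -> W u -> W v -> W (u - v).
Proof. by move=> sW Wu Wv; apply: subspaceD => //; exact: subspaceN. Qed.

Lemma subspace_sum W U : subspace W -> subspace U ->
  subspace [set w + u | w in W & u in U].
Proof.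
move=> sW sU; apply/subspaceP; split.
- by exists 0; [exact: subspace0|exists 0; [exact: subspace0|rewrite addr0]].
- move=> _ _ [w Ww [u Uu <-]] [w' Ww' [u' Uu' <-]].
  exists (w + w'); first exact: subspaceD.
  by exists (u + u'); [exact: subspaceD|rewrite addrACA].
- move=> a _ [w Ww [u Uu <-]]; exists (a *: w); first exact: subspaceZ.
  by exists (a *: u); [exact: subspaceZ|rewrite scalerDr].
Qed.

(** A subspace [X] that is maximal among those that contain [W] but not [v] is a
    hyperplane complementary to the line of [v]; the functional is the
    coordinate along [v]. *)
Lemma separating_functional W v : subspace W -> ~ W v ->
  exists f : V -> F, [/\ scalar f, forall w, W w -> f w = 0 & f v = 1].
Proof.
move=> sW nWv.
(* the empty set is admitted for the sake of the union of the empty chain *)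
pose P X := X = set0 \/ [/\ subspace X, W `<=` X & ~ X v].
have [X [PX maxX]] : exists X, P X /\ forall Y, X `<` Y -> ~ P Y.
  apply: Zorn_bigcup => E EP totE.
  have [[X EX X0]|nE] := pselect (exists2 X, E X & X !=set0); last first.
    left; apply/seteqP; split=> // x [X EX Xx]; apply: nE.
    by exists X => //; exists x.
  right; have PE Y : E Y -> Y !=set0 -> [/\ subspace Y, W `<=` Y & ~ Y v].
    by move=> EY [y Yy]; case: (EP _ EY) => // Y0; move: Yy; rewrite Y0.
  have [sX WX nXv] := PE _ EX X0.
  split.
  - apply/subspaceP; split.
    + by exists X => //; exact: subspace0.
    + move=> x y [Y EY Yx] [Z EZ Zy].
      have [sY _ _] := PE _ EY (ex_intro _ _ Yx).
      have [sZ _ _] := PE _ EZ (ex_intro _ _ Zy).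
      case: (totE _ _ EY EZ) => YZ.
        by exists Z => //; apply: subspaceD => //; exact: YZ.
      by exists Y => //; apply: subspaceD => //; exact: YZ.
    + move=> a x [Y EY Yx]; exists Y => //.
      by apply: subspaceZ => //; case: (PE _ EY (ex_intro _ _ Yx)).
  - by move=> w Ww; exists X => //; exact: WX.
  - by move=> [Y EY Yv]; case: (PE _ EY (ex_intro _ _ Yv)).
have {PX}[sX WX nXv] : [/\ subspace X, W `<=` X & ~ X v].
  case: PX => // X0; exfalso; apply: (maxX W); last by right; split=> // u Wu.
  rewrite X0; split=> // /(_ 0) /=; apply; exact: subspace0.
have decomp x : exists a, X (x - a *: v).
  apply: contrapT => /forallNP nXx.
  (* otherwise the sum of X and the line of x would be a larger candidate *)
  pose Z := [set u | exists b, X (u - b *: x)].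
  have XZ : X `<=` Z by move=> u Xu; exists 0; rewrite scale0r subr0.
  have sZ : subspace Z.
    apply/subspaceP; split; first by apply: XZ; exact: subspace0.
    - move=> u w [a Xa] [b Xb]; exists (a + b).
      by rewrite scalerDl opprD addrACA; exact: subspaceD.
    - move=> a u [b Xb]; exists (a * b).
      by rewrite -scalerA -scalerBr; exact: subspaceZ.
  exfalso; apply: (maxX Z).
    split=> // ZX; apply: (nXx 0); rewrite scale0r subr0; apply: ZX.
    by exists 1; rewrite scale1r subrr; exact: subspace0.
  right; split=> //; first by move=> u /WX/XZ.
  case=> b Xb; have [b0|b0] := eqVneq b 0.
    by apply: nXv; move: Xb; rewrite b0 scale0r subr0.
  apply: (nXx b^-1); have := subspaceZ (- b^-1) sX Xb.
  by rewrite scalerBr !scaleNr opprK scalerA mulVf // scale1r addrC.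
have uniq_coef x a b : X (x - a *: v) -> X (x - b *: v) -> a = b.
  move=> Xa Xb; apply/eqP; rewrite -subr_eq0; apply/negP => /negP ab.
  apply: nXv; have := subspaceZ (a - b)^-1 sX (subspaceB sX Xb Xa).
  have -> : x - b *: v - (x - a *: v) = (a - b) *: v.
    by rewrite opprB [LHS]addrC subrKA scalerBl.
  by rewrite scalerA mulVf // scale1r.
have /choice[f fP] := decomp.
exists f; split.
- move=> a x y; apply: (uniq_coef (a *: x + y)) => //.
  rewrite scalerDl opprD addrACA -scalerA -scalerBr.
  by apply: subspaceD => //; exact: subspaceZ.
- move=> w Ww; apply: (uniq_coef w) => //.
  by rewrite scale0r subr0; exact: WX.
- apply: (uniq_coef v) => //; by rewrite scale1r subrr; exact: subspace0.
Qed.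

End Subspaces.

(** * The stabilizer of a series *)

Section StabilityGroup.
Local Open Scope classical_set_scope.
Local Open Scope ring_scope.
Variables (F : fieldType) (V : lmodType F).
Implicit Types (W U B T : set V) (u v w : V) (g h x : GL V) (phi psi : V -> V).

Lemma linear_pack phi : linear phi -> exists f : {linear V -> V}, phi = f.
Proof.
move=> lphi; pose A := GRing.isLinear.Build F V V _ phi lphi.
by exists (HB.pack_for {linear V -> V} phi A).
Qed.

Lemma GL_mulE g h v : (g * h)%g v = h (g v). Proof. by []. Qed.

Lemma GL_VK g v : g ((g^-1)%g v) = v.
Proof. by rewrite -GL_mulE mulVg. Qed.

Lemma GL_KV g v : (g^-1)%g (g v) = v.
Proof. by rewrite -GL_mulE mulgV. Qed.

HB.instance Definition _ g :=
  GRing.isLinear.Build F V V _ (g : V -> V) (GL_linear g).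

Variable L : set (set V).
Hypothesis hL : is_series L.

Lemma series_subspace W : L W -> subspace W.
Proof. by case: hL => + _ _ _ _; apply. Qed.

Lemma series_total W U : L W -> L U -> W `<=` U \/ U `<=` W.
Proof. by case: hL => _ + _ _ _; apply. Qed.

Lemma series_zero : L [set 0]. Proof. by case: hL => _ _ []. Qed.

(** The bottom is the union of the members of [L] that avoid [v], the top the
    intersection of those that contain it. *)
Lemma jump_at v : v != 0 -> exists B T, [/\ jump L B T, ~ B v, T v,
  (forall W, L W -> W v -> T `<=` W) & (forall W, L W -> ~ W v -> W `<=` B)].
Proof.
move=> v0; case: (hL) => _ _ _ LI LU.
exists (\bigcup_(W in [set W | L W /\ ~ W v]) W),
  (\bigcap_(W in [set W | L W /\ W v]) W).
have nB : ~ (\bigcup_(W in [set W | L W /\ ~ W v]) W) v by move=> [W []].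
have TT : (\bigcap_(W in [set W | L W /\ W v]) W) v by move=> W [].
split=> //; last 2 first.
- by move=> W LW Wv u; apply.
- by move=> W LW nWv u Wu; exists W.
split.
- apply: LU => [W []//|]; exists [set 0]; split; first exact: series_zero.
  by move/eqP; apply/negP.
- by apply: LI => W [].
- split=> [u [W [LW nWv] Wu] U [LU' Uv]|/(_ _ TT) //].
  case: (series_total LW LU') => [|UW]; first exact.
  by case: nWv; exact: UW.
- move=> W LW [[BW nWB] [WT nTW]]; have [Wv|nWv] := pselect (W v).
    by apply: nTW => u; apply.
  by apply: nWB => u Wu; exists W.
Qed.

Lemma jump_split B T W : jump L B T -> L W -> T `<=` W \/ W `<=` B.
Proof.
move=> [LB LT _ nBT] LW.
have [TW|nTW] := pselect (T `<=` W); first by left.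
have [WB|nWB] := pselect (W `<=` B); [by right|exfalso].
apply: (nBT W LW); split; split=> //.
  by case: (series_total LB LW).
by case: (series_total LT LW).
Qed.

Notation S := (stability_group L).

Lemma stability_sub g W v : S g -> L W -> W v -> W (g v).
Proof.
move=> Sg LW Wv; have [->|v0] := eqVneq v 0.
  by rewrite linear0; apply: subspace0; exact: series_subspace.
have [B [T [jBT _ Tv TW _]]] := jump_at v0.
have [_ _ [BT _] _] := jBT.
rewrite -[g v](subrK v); apply: subspaceD => //; first exact: series_subspace.
by apply/(TW _ LW Wv)/BT; apply: (Sg _ _ jBT); exists v.
Qed.

(** If [v] were outside [W], then [W] would lie in the bottom [B] of the jump at
    [v]; then [B] would contain both [g v] and [g v - v]. *)
Lemma stability_subV g W v : S g -> L W -> W (g v) -> W v.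
Proof.
move=> Sg LW Wgv; have [->|v0] := eqVneq v 0.
  by apply: subspace0; exact: series_subspace.
have [B [T [jBT nBv Tv TW WB]]] := jump_at v0; have [LB _ _ _] := jBT.
apply: contrapT => nWv; apply: nBv.
have -> : v = g v - (g v - v) by rewrite subKr.
apply: subspaceB; [exact: series_subspace|exact: (WB W)|].
by apply: (Sg _ _ jBT); exists v.
Qed.

Lemma stability_subgroup : subgroup S.
Proof.
apply/subgroupP; split=>
  [B T [LB _ _ _] _ [v Tv <-]|g h Sg Sh B T jBT|g Sg B T jBT] /=.
- by rewrite /= subrr; apply: subspace0; exact: series_subspace.
- move=> _ [v Tv <-]; have [LB LT _ _] := jBT.
  rewrite GL_mulE -(subrKA (g v)); apply: subspaceD; first exact: series_subspace.
    by apply: (Sh _ _ jBT); exists (g v) => //; exact: stability_sub.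
  by apply: (Sg _ _ jBT); exists v.
- move=> _ [v Tv <-]; have [LB LT _ _] := jBT.
  rewrite -opprB; apply: subspaceN; first exact: series_subspace.
  apply: (Sg _ _ jBT); exists ((g^-1)%g v); last by rewrite GL_VK.
  by apply: (stability_subV Sg) => //; rewrite GL_VK.
Qed.

(** * Commutators with square-zero perturbations of the identity *)

Definition lowers phi := forall B T v, jump L B T -> T v -> B (phi v).

Lemma transvection_exists phi :
  linear phi -> (forall v, phi (phi v) = 0) -> lowers phi ->
  exists2 x, S x & forall v, x v = v + phi v.
Proof.
move=> /linear_pack[f ->] f2 low.
suff P : `[< linear (fun v => v + f v) /\ bijective (fun v => v + f v) >].
  exists (MkGL P) => // B T jBT _ [v Tv <-] /=.
  by rewrite addrC addKr; exact: (low B T).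
apply/asboolP; split; first by move=> a u v; rewrite linearP scalerDr addrACA.
exists (fun v => v - f v) => v /=.
  by rewrite [f (_ + _)]linearD f2 addr0 addrK.
by rewrite [f (_ - _)]linearB f2 subr0 subrK.
Qed.

Variable g : GL V.
Hypothesis Sg : S g.

Definition delta v := g v - v.

Lemma delta_linear : linear delta.
Proof. by move=> a u v; rewrite /delta GL_linear opprD addrACA scalerBr. Qed.
HB.instance Definition _ := GRing.isLinear.Build F V V _ delta delta_linear.

(** The [n]-th iterate of [phi |-> delta phi - phi delta], evaluated at [v]. *)
Fixpoint iter_ad phi n v :=
  if n is m.+1 then delta (iter_ad phi m v) - iter_ad phi m (delta v) else phi v.

Lemma iter_ad_linear phi n : linear phi -> linear (iter_ad phi n).
Proof.
move=> lphi; elim: n => //= n IH a u v.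
by rewrite delta_linear !IH delta_linear opprD addrACA scalerBr.
Qed.

Definition centraliser h := S h /\ (g * h = h * g)%g.

Lemma centraliser_subgroup : subgroup [set h | centraliser h].
Proof.
have sS := stability_subgroup.
apply/subgroupP; split=> [|h k [Sh Ch] [Sk Ck]|h [Sh Ch]].
- by split; [exact: (subgroup1 sS)|rewrite mulg1 mul1g].
- by split; [exact: (subgroupM sS)|rewrite mulgA Ch -!mulgA Ck].
- split; first exact: (subgroupV sS).
  by apply: (mulgI h); rewrite mulgA -Ch -mulgA mulgV mulg1 mulVKg.
Qed.

Lemma centraliser_delta h v : centraliser h -> h (delta v) = delta (h v).
Proof. by move=> [_ Ch]; rewrite /delta linearB /= -GL_mulE Ch. Qed.

(** The centraliser of [g] is chosen here because every subspace used below, the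
    members of [L] and the kernels of the powers of [delta], is invariant under
    it. It makes the condition inherited by [g phi g^-1] and by differences of
    such conjugates. *)
Definition square_zero phi := forall h v, centraliser h -> phi (h (phi v)) = 0.

Lemma centraliser_self : centraliser g. Proof. by []. Qed.

(** [x^-1 = 1 - phi] and [phi g^-1 phi = 0] reduce the commutator to
    [1 + (g phi g^-1 - phi)], where products are compositions of functions. *)
Lemma transvection_commutator phi x : linear phi -> square_zero phi ->
  (forall v, x v = v + phi v) ->
  forall v, [~ x, g]%g v = v + (g (phi (g^-1 v)%g) - phi v).
Proof.
move=> /linear_pack[f ->] sq xE v.
have C1 : centraliser 1%g := subgroup1 centraliser_subgroup.
have CV : centraliser (g^-1)%g := subgroupV centraliser_subgroup centraliser_self.
have xV : (x^-1)%g v = v - f v.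
  have {1}-> : v = x (v - f v); last by rewrite GL_KV.
  by rewrite xE linearB (sq _ v C1) subr0 subrK.
rewrite commgEl conjgE !GL_mulE xV xE.
rewrite !linearB /= (sq _ v CV) subr0.
by rewrite linearD /= linearB /= !GL_VK -addrA [- _ + _]addrC.
Qed.

(** Iterating [phi |-> g phi g^-1 - phi]: composing the [n]-th iterate with [g ^ n]
    clears the inverses and gives [iter_ad phi n], since
    [g phi - phi g = delta phi - phi delta]. *)
Lemma engel_transvection phi x n : linear phi -> square_zero phi ->
  (forall v, x v = v + phi v) ->
  exists psi, [/\ linear psi, square_zero psi,
    forall v, (iter n (fun y => [~ y, g]%g) x) v = v + psi v &
    forall v, psi (iter n g v) = iter_ad phi n v].
Proof.
move=> lphi sq xE; elim: n => [|n [psi [lpsi sqpsi xn psin]]]; first by exists phi.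
have CV : centraliser (g^-1)%g := subgroupV centraliser_subgroup centraliser_self.
have lad := iter_ad_linear n lphi.
exists (fun v => g (psi (g^-1 v)%g) - psi v); split.
- by move=> a u v; rewrite GL_linear !lpsi GL_linear opprD addrACA scalerBr.
- move=> h v Ch; move: sqpsi; have [f ->] := linear_pack lpsi => sqf.
  have Ck k : centraliser k -> centraliser (g * k)%g /\ centraliser (k * g^-1)%g.
    move=> Ck; split; apply: (subgroupM centraliser_subgroup) => //.
  have [C1 C2] := Ck _ Ch; have [_ C3] := Ck _ C1.
  have E1 w : f (h (g (f w))) = 0 := sqf (g * h)%g w C1.
  have E2 w : f ((g^-1)%g (h (f w))) = 0 := sqf (h * g^-1)%g w C2.
  have E3 w : f ((g^-1)%g (h (g (f w)))) = 0 := sqf (g * h * g^-1)%g w C3.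
  by rewrite !linearB /= E1 E2 E3 sqf // ?subrr ?linear0 ?subrr ?addr0 ?linear0.
- by move=> v; rewrite iterS (transvection_commutator lpsi sqpsi xn).
- move=> v; rewrite iterS GL_KV /= psin -iterS iterSr psin.
  move: lad => /linear_pack[f ->].
  by rewrite /delta linearB /= opprB subrKA.
Qed.

Hypothesis engel : forall x, S x -> exists n, iter n (fun y => [~ y, g]%g) x = 1%g.

Lemma engel_iter_ad phi : linear phi -> lowers phi -> square_zero phi ->
  exists n, forall v, iter_ad phi n v = 0.
Proof.
move=> lphi low sq.
have C1 : centraliser 1%g := subgroup1 centraliser_subgroup.
have [x Sx xE] := transvection_exists lphi (fun v => sq _ v C1) low.
have [n xn] := engel Sx.
have [psi [_ _ psiE psin]] := engel_transvection n lphi sq xE.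
exists n => v; rewrite -psin; apply: (addrI (iter n g v)).
by rewrite -psiE xn addr0.
Qed.


Lemma delta_jump B T v : jump L B T -> T v -> B (delta v).
Proof.
move=> jBT Tv; have TB : commutator_space T g `<=` B := Sg jBT.
by apply: TB; exists v.
Qed.

(** * Local nilpotency of [g - 1] *)

Lemma iter_delta_linear n : linear (iter n delta).
Proof. by elim: n => // n IH a u v; rewrite !iterS IH delta_linear. Qed.

Lemma iter_delta0 n : iter n delta 0 = 0.
Proof. by elim: n => //= n ->; rewrite linear0. Qed.

Lemma delta_sub W v : L W -> W v -> W (delta v).
Proof.
move=> LW Wv; apply: subspaceB => //; first exact: series_subspace.
exact: stability_sub.
Qed.

Lemma iter_delta_sub W n v : L W -> W v -> W (iter n delta v).
Proof. by move=> LW Wv; elim: n => //= n; exact: delta_sub. Qed.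

Definition kernel m := [set v | iter m delta v = 0].

Lemma kernel_subspace m : subspace (kernel m).
Proof.
have := iter_delta_linear m; rewrite /kernel => /linear_pack[f ->].
apply/subspaceP; split=> /= [|u v Ku Kv|a u Ku]; first exact: linear0.
  by rewrite linearD Ku Kv addr0.
by rewrite linearZ /= Ku scaler0.
Qed.

Lemma kernel_le m n : (m <= n)%N -> kernel m `<=` kernel n.
Proof.
by move=> mn v Kv; rewrite /kernel /= -(subnK mn) iterD Kv iter_delta0.
Qed.

Lemma kernel_centraliser m h v : centraliser h -> kernel m v -> kernel m (h v).
Proof.
move=> Ch Kv; rewrite /kernel /=.
have -> : iter m delta (h v) = h (iter m delta v).
  by elim: m {Kv} => //= m ->; rewrite centraliser_delta.
by rewrite Kv linear0.
Qed.

Lemma kernel_delta m v : kernel m v -> kernel m (delta v).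
Proof. by move=> Kv; rewrite /kernel /= -iterSr iterS Kv linear0. Qed.

Definition rank_one (f : V -> F) u v := f v *: u.

Lemma rank_one_linear f u : scalar f -> linear (rank_one f u).
Proof. by move=> lf a x y; rewrite /rank_one lf scalerDl scalerA. Qed.

Lemma rank_one_lowers W f u : L W -> W u -> (forall v, W v -> f v = 0) ->
  lowers (rank_one f u).
Proof.
move=> LW Wu fW B T v jBT Tv; have [LB _ _ _] := jBT.
case: (jump_split jBT LW) => [TW|]; last first.
  by move=> WB; apply: subspaceZ; [exact: series_subspace|exact: WB].
rewrite /rank_one fW ?scale0r; last exact: TW.
by apply: subspace0; exact: series_subspace.
Qed.

(** The span of [u], [delta u], ..., [delta ^ (n - 1) u], peeled off from the side
    of [u], as needed in [monic_relation]. *)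
Fixpoint iterate_span n u : set V :=
  if n is m.+1 then
    [set x | exists a y, iterate_span m (delta u) y /\ x = a *: u + y]
  else [set 0].

Lemma iterate_span_subspace n u : subspace (iterate_span n u).
Proof.
elim: n u => /= [|n IH] u.
  by apply/subspaceP; split=> [//|_ _ -> ->|a _ ->]; rewrite ?addr0 ?scaler0.
apply/subspaceP; split.
- by exists 0, 0; rewrite scale0r addr0; split=> //; exact: subspace0.
- move=> _ _ [a [x [Hx ->]]] [b [y [Hy ->]]]; exists (a + b), (x + y).
  by split; [exact: subspaceD|rewrite scalerDl addrACA].
- move=> a _ [b [x [Hx ->]]]; exists (a * b), (a *: x).
  by split; [exact: subspaceZ|rewrite scalerDr scalerA].
Qed.

Lemma iterate_spanS n u : iterate_span n u `<=` iterate_span n.+1 u.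
Proof.
elim: n u => [|n IH] u x; last first.
  by move=> [a [y [/IH Hy ->]]]; exists a, y.
by move=> ->; exact: subspace0 (iterate_span_subspace _ _).
Qed.

Lemma iterate_span_delta_sub n u : iterate_span n (delta u) `<=` iterate_span n.+1 u.
Proof. by move=> x Hx; exists 0, x; rewrite scale0r add0r. Qed.

Lemma iterate_span_delta n u v : iterate_span n u v -> iterate_span n.+1 u (delta v).
Proof.
move=> Hv; apply: iterate_span_delta_sub.
elim: n u v Hv => [|n IH] u v; first by move=> ->; rewrite linear0.
by move=> [a [y [/IH Hy ->]]]; exists a, (delta y); rewrite linearP.
Qed.

Lemma iterate_span_iter n u : iterate_span n.+1 u (iter n delta u).
Proof.
elim: n u => [|n IH] u; first by exists 1, 0; rewrite scale1r addr0.
by rewrite iterSr; apply: iterate_span_delta_sub; exact: IH.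
Qed.

Lemma iterate_span_sub W n u : L W -> W u -> iterate_span n u `<=` W.
Proof.
move=> LW; have sW := series_subspace LW.
elim: n u => [|n IH] u Wu x; first by move=> ->; exact: subspace0.
move=> [a [y [Hy ->]]]; apply: subspaceD => //; first exact: subspaceZ.
by apply: IH Hy; exact: delta_sub.
Qed.

Lemma iter_ad_rank_one f u n v :
  exists2 y, iterate_span n u y &
    iter_ad (rank_one f u) n v = f v *: iter n delta u + y.
Proof.
elim: n v => [|n IH] v; first by exists 0; rewrite ?addr0.
have sD := iterate_span_subspace n.+1 u.
have [y Hy Ey] := IH v; have [z Hz Ez] := IH (delta v).
exists (delta y - (f (delta v) *: iter n delta u + z)); last first.
  by rewrite /= Ey Ez delta_linear -addrA.
apply: subspaceB => //; first exact: iterate_span_delta.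
apply: subspaceD => //; last exact: iterate_spanS.
by apply: subspaceZ => //; exact: iterate_span_iter.
Qed.

(** Let [a u] be the term of lowest order in the relation, with [a] nonzero. All
    other terms lie in the bottom of the jump at [u], while [u] does not, so
    [u = 0]. *)
Lemma monic_relation n u y :
  iterate_span n u y -> iter n delta u + y = 0 -> iter n delta u = 0.
Proof.
elim: n u y => [|n IH] u y; first by move=> ->; rewrite addr0.
move=> [a [z [Hz ->]]] E; have [a0|a0] := eqVneq a 0.
  by rewrite iterSr; apply: IH Hz _; rewrite -iterSr -E a0 scale0r add0r.
have [->|u0] := eqVneq u 0; first exact: iter_delta0.
have [B [T [jBT nBu Tu _ _]]] := jump_at u0; have [LB _ _ _] := jBT.
have sB := series_subspace LB.
have Bdu := delta_jump jBT Tu.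
exfalso; apply: nBu; rewrite -[u]scale1r -(mulVf a0) -scalerA.
apply: subspaceZ => //.
have -> : a *: u = - (iter n delta (delta u) + z).
  by apply/eqP; rewrite -subr_eq0 opprK -iterSr addrCA E.
apply: subspaceN => //; apply: subspaceD => //; first exact: iter_delta_sub.
exact: iterate_span_sub Hz.
Qed.

Lemma rank_one_square_zero W f u : L W -> W u -> (forall v, W v -> f v = 0) ->
  square_zero (rank_one f u).
Proof.
move=> LW Wu fW h v [Sh _]; rewrite /rank_one linearZ /= fW ?scale0r //.
apply: subspaceZ; first exact: series_subspace.
exact: stability_sub.
Qed.

(** For a functional [f] with [f v = 1], the Engel condition for [rank_one f u],
    evaluated at [v], is a monic relation between the iterates of [u]. *)
Lemma delta_nilpotent_proper W u v : L W -> W u -> ~ W v -> exists n, kernel n u.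
Proof.
move=> LW Wu nWv; have sW := series_subspace LW.
have [f [lf fW fv]] := separating_functional sW nWv.
have [n En] := engel_iter_ad (rank_one_linear u lf)
  (rank_one_lowers LW Wu fW) (rank_one_square_zero LW Wu fW).
exists n; have [y Hy] := iter_ad_rank_one f u n v.
rewrite En fv scale1r => /esym; exact: monic_relation.
Qed.

(** For nonzero [v] the vector [delta v] lies in the bottom of the jump at [v],
    which is a proper member of the series. *)
Lemma delta_locally_nilpotent v : exists n, kernel n v.
Proof.
have [->|v0] := eqVneq v 0; first by exists 0%N.
have [B [T [jBT nBv Tv _ _]]] := jump_at v0; have [LB _ _ _] := jBT.
have Bdv := delta_jump jBT Tv.
have [n Kn] := delta_nilpotent_proper LB Bdv nBv.
by exists n.+1; rewrite /kernel /= -iterS iterSr.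
Qed.

Lemma last_iterate U v : U 0 -> ~ U v ->
  exists i, ~ U (iter i delta v) /\ U (iter i.+1 delta v).
Proof.
have [m] := delta_locally_nilpotent v; move=> + U0.
elim: m v => [|m IH] v Kv nUv; first by case: nUv; have -> : v = 0 by exact: Kv.
have [Udv|nUdv] := pselect (U (delta v)); first by exists 0%N.
have [|i] := IH (delta v) _ nUdv; first by rewrite /kernel /= -iterSr.
by rewrite -!iterSr; exists i.+1.
Qed.

Lemma iter_ad_rank_one_top f u v n : (forall i, f (iter i.+1 delta v) = 0) ->
  iter_ad (rank_one f u) n v = f v *: iter n delta u.
Proof.
elim: n v => // n IH v fv /=; rewrite IH // IH => [|i]; last by rewrite -iterSr.
by rewrite (fv 0%N) scale0r subr0 linearZ.
Qed.

Lemma iter_ad_rank_one_bottom f u n v : delta u = 0 ->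
  iter_ad (rank_one f u) n v = ((-1) ^+ n * f (iter n delta v)) *: u.
Proof.
move=> du; elim: n v => [|n IH] v /=; first by rewrite mul1r.
by rewrite !IH linearZ /= du scaler0 sub0r -scaleNr exprS mulN1r mulNr -iterSr.
Qed.

Lemma iter_adD phi psi n v :
  iter_ad (fun v => phi v + psi v) n v = iter_ad phi n v + iter_ad psi n v.
Proof. by elim: n v => //= n IH v; rewrite !IH linearD /= opprD addrACA. Qed.

Lemma eq_iter_ad m phi psi n v : (forall v, kernel m v -> phi v = psi v) ->
  kernel m v -> iter_ad phi n v = iter_ad psi n v.
Proof.
move=> E; elim: n v => [|n IH] v Kv /=; first exact: E.
by rewrite !IH //; exact: kernel_delta.
Qed.


(** * Nilpotency of [g - 1] *)

(** The finite partial sums of the map [f_0 u_0 + f_1 u_1 + ...] under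
    construction: [vanishing] is the last member [W_k] of the series, on which
    the sum vanishes, and [bound] an exponent [m] such that the terms still to
    be added vanish on [kernel m]. *)
Record approximation := Approximation {
  vanishing : set V; bound : nat; map_of :> V -> V }.

Definition valid (s : approximation) := [/\ linear s, lowers s, square_zero s,
  forall v, vanishing s v -> s v = 0 & forall v, kernel (bound s) (s v)].

(** The vector [z] witnesses that the iterate of order [bound s] is nonzero; it lies
    in a kernel on which later refinements agree with [t]. *)
Definition refines (s t : approximation) :=
  [/\ (bound s < bound t)%N, forall v, kernel (bound s) v -> t v = s v &
      exists2 z, kernel (bound t) z & iter_ad t (bound s) z != 0].

(** By local nilpotency every vector lies in some [kernel (bound (s n))], from
    which on its image is stable; the limit inherits validity, and none of its
    iterates vanishes, against the Engel condition. *)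
Lemma limit_not_engel (s : nat -> approximation) :
  (forall n, valid (s n)) -> (forall n, refines (s n) (s n.+1)) -> False.
Proof.
move=> vs rs; pose m n := bound (s n).
have mS n : (m n < m n.+1)%N by case: (rs n).
have mge n : (n <= m n)%N by elim: n => // n IH; exact: leq_ltn_trans (mS n).
have mle n k : (m n <= m (n + k))%N.
  by elim: k => [|k IH]; rewrite ?addn0 // addnS; exact: leq_trans (ltnW (mS _)).
have stable n k v : kernel (m n) v -> s (n + k)%N v = s n v.
  move=> Kv; elim: k => [|k IH]; rewrite ?addn0 // addnS -IH.
  by case: (rs (n + k)%N) => _ E _; apply: E; exact: kernel_le (mle _ _) _ Kv.
have /choice[N NP] : forall v, exists n, kernel (m n) v.
  move=> v; have [n Kn] := delta_locally_nilpotent v.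
  by exists n; exact: kernel_le (mge n) _ Kn.
pose phi v := s (N v) v.
have phiE n v : kernel (m n) v -> phi v = s n v.
  by move=> Kv; rewrite /phi -(stable _ n _ (NP v)) addnC stable.
have common u v : exists2 n, kernel (m n) u & kernel (m n) v.
  exists (N u + N v)%N; first exact: kernel_le (mle _ _) _ (NP u).
  by rewrite addnC; exact: kernel_le (mle _ _) _ (NP v).
have lphi : linear phi.
  move=> a u v; have [n Ku Kv] := common u v.
  have sK := kernel_subspace (m n).
  rewrite !(phiE n) //; first by case: (vs n) => + _ _ _ _; apply.
  by apply: subspaceD => //; exact: subspaceZ.
have low : lowers phi.
  by move=> B T v jBT Tv; case: (vs (N v)) => _ lown _ _ _; exact: lown jBT Tv.
have sq : square_zero phi.
  move=> h v Ch; rewrite [phi v]/phi; have [_ _ sqs _ imK] := vs (N v).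
  rewrite (phiE (N v)); last exact: kernel_centraliser.
  exact: sqs.
have [n En] := engel_iter_ad lphi low sq.
have [_ _ [z Kz]] := rs n; apply/negP/negPn/eqP.
rewrite -(eq_iter_ad (m := m n.+1) (phi := phi)) // => [|v Kv]; last exact: phiE.
(* once an iterate vanishes, all later ones do, and [m n >= n] *)
have := mge n; rewrite /m => /subnK <-.
by elim: (_ - _)%N z {Kz} => [|k IH] z; rewrite ?add0n // addSn /= !IH linear0 subr0.
Qed.

(** It is enough to find, for each [W] in a family [A] and each [m], a single rank
    one map, independently of the terms chosen before: [iter_ad] is additive, so
    if the present sum [s] has a zero iterate of order [m], then the sum with
    the new term has a nonzero one; otherwise [s] itself is kept. *)
Lemma refinement_contradiction (A : set (set V)) W0 : A `<=` L -> A W0 ->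
  (forall W m, A W -> exists U f u,
     [/\ A U, U `<=` W, U u & scalar f] /\
     [/\ forall v, U v -> f v = 0, forall v, kernel m v -> f v = 0 &
         exists z, iter_ad (rank_one f u) m z != 0]) -> False.
Proof.
move=> AL AW0 step.
pose ok s := valid s /\ A (vanishing s).
have ok0 : ok (Approximation W0 0 (fun=> 0)).
  split=> //; split=> //.
  - by move=> a u v; rewrite scaler0 addr0.
  - move=> B T v [LB _ _ _] _; apply: subspace0; exact: series_subspace.
have next (s : {s | ok s}) : {t : {s | ok s} | refines (sval s) (sval t)}.
  apply: cid; case: s => s [[lphi low sq van im] As] /=.
  have [U [f [u [[AU UW Uu lf] [fU fK [z nz]]]]]] := step _ (bound s) As.
  have LU := AL _ AU; have sU := series_subspace LU.
  have [phi [[lphi' low' sq' van'] [agree [y ny] imf]]] : exists phi : V -> V,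
     [/\ linear phi, lowers phi, square_zero phi & forall v, U v -> phi v = 0] /\
     [/\ forall v, kernel (bound s) v -> phi v = s v,
       exists y, iter_ad phi (bound s) y != 0
       & forall v, exists a, phi v = s v + a *: u].
    have [[y ny]|E] := pselect (exists y, iter_ad s (bound s) y != 0).
      exists s; split; split=> //; [by move=> v /UW; exact: van|by exists y|].
      by move=> v; exists 0; rewrite scale0r addr0.
    exists (fun v => s v + rank_one f u v); split; split.
    - by move=> a v w; rewrite lphi rank_one_linear // scalerDr addrACA.
    - move=> B T v jBT Tv; have [LB _ _ _] := jBT; apply: subspaceD.
      + exact: series_subspace.
      + exact: low jBT Tv.
      + exact: (rank_one_lowers LU Uu fU jBT Tv).
    - move=> h v Ch.
      have Uhu : U (h u) by case: Ch => Sh _; exact: (stability_sub Sh).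
      have Khs : kernel (bound s) (h (s v)) by exact: kernel_centraliser.
      have -> : h (s v + rank_one f u v) = f v *: h u + h (s v).
        by rewrite linearD linearZ addrC.
      rewrite /rank_one lphi lf (van _ (UW _ Uhu)) (sq _ _ Ch) (fU _ Uhu) (fK _ Khs).
      by rewrite scaler0 mulr0 !add0r scale0r.
    - by move=> v Uv; rewrite /rank_one van ?fU ?scale0r ?addr0 //; exact: UW.
    - by move=> v Kv; rewrite /rank_one fK // scale0r addr0.
    - exists z; rewrite iter_adD; have [->|ny] := eqVneq (iter_ad s (bound s) z) 0.
        by rewrite add0r.
      by case: E; exists z.
    - by move=> v; exists (f v).
  have [p Kp] := delta_locally_nilpotent u.
  have [q Kq] := delta_locally_nilpotent y.
  (* the new bound exceeds the old one, and its kernel contains the new image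
     vector [u] and the new witness [y] *)
  pose b := ((bound s).+1 + p + q)%N.
  have K1 : kernel (bound s) `<=` kernel b.
    by apply: kernel_le; rewrite /b -addnA addSn leqW // leq_addr.
  have Kpb : kernel p `<=` kernel b by apply: kernel_le; rewrite /b addnAC leq_addl.
  have Kqb : kernel q `<=` kernel b by apply: kernel_le; rewrite /b leq_addl.
  have okt : ok (Approximation U b phi).
    split=> //; split=> // v /=; have [a ->] := imf v.
    have sb := kernel_subspace b.
    apply: subspaceD => //; first exact: K1.
    by apply: subspaceZ => //; exact: Kpb.
  exists (exist _ _ okt); split=> //=; first by rewrite /b -addnA leq_addr.
  by exists y => //; exact: Kqb.
have [s [_ sP]] := dependent_choice next (exist _ _ ok0).
by apply: (limit_not_engel (s := fun n => sval (s n))) => // n; case: (s n) => t [].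
Qed.


Definition plus_kernel W m := [set w + k | w in W & k in kernel m].

Lemma plus_kernel_functional W m v : L W -> ~ plus_kernel W m v ->
  exists f : V -> F, [/\ scalar f, f v = 1, forall w, plus_kernel W m w -> f w = 0,
    forall w, W w -> f w = 0 & forall w, kernel m w -> f w = 0].
Proof.
move=> LW nWv; have sW := series_subspace LW; have sK := kernel_subspace m.
have [f [lf f0 fv]] := separating_functional (subspace_sum sW sK) nWv.
exists f; split=> // w Ww; apply: f0.
  by exists w => //; exists 0; [exact: subspace0|rewrite addr0].
by exists 0; [exact: subspace0|exists w => //; rewrite add0r].
Qed.

Lemma plus_kernel_iter W m v : L W -> plus_kernel W m v -> W (iter m delta v).
Proof.
move=> LW [w Ww [k Kk <-]].
have := iter_delta_linear m; have Ew := iter_delta_sub m LW Ww; move: Kk Ew.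
rewrite /kernel /= => Kk Ew /(_ 1 w k).
by rewrite !scale1r Kk addr0 => ->.
Qed.

Lemma plus_kernel_delta W m v :
  L W -> plus_kernel W m v -> plus_kernel W m (delta v).
Proof.
move=> LW [w Ww [k Kk <-]]; exists (delta w); first exact: delta_sub.
by exists (delta k); [exact: kernel_delta|rewrite linearD].
Qed.

(** Otherwise take [u] in [W] with [delta u = 0], and [f] vanishing on [W] and
    [kernel m] but not on the image of [delta ^ m]: then the iterate of order [m]
    of [rank_one f u] is, up to sign, [rank_one (f delta ^ m) u]. *)
Lemma unipotent_quotient W w : L W -> W w -> w != 0 ->
  exists n, forall v, W (iter n delta v).
Proof.
move=> LW Ww w0; apply: contrapT => /forallNP nuni.
have sW := series_subspace LW.
have [i [/eqP u0 du0]] :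
    exists i, ~ [set 0] (iter i delta w) /\ [set 0] (iter i.+1 delta w).
  by apply: last_iterate => //; exact/eqP.
pose u := iter i delta w; have Wu : W u by exact: iter_delta_sub.
apply: (@refinement_contradiction [set W] W) => [_ -> //|//|_ m ->].
(* [delta ^ (2 m) v] outside [W] puts [delta ^ m v] outside [W + kernel m] *)
have /existsNP[v nWv] := nuni (m + m)%N.
have [|f [lf fv _ fW fK]] := @plus_kernel_functional W m (iter m delta v) LW.
  by move/(plus_kernel_iter LW); rewrite -iterD.
exists W, f, u; split=> //; split=> //; exists v.
by rewrite iter_ad_rank_one_bottom // fv mulr1 scaler_eq0 signr_eq0.
Qed.

(** Suppose not. As [delta] is nilpotent modulo each nonzero [W] in [L], its powers
    have nonzero restrictions to each of them. Given [m], take [f] vanishing on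
    [U + kernel m] and on all [delta ^ j v] with [j > 0], with [f v = 1]: at [v]
    the iterate of order [m] of [rank_one f u] is [delta ^ m u], which is nonzero
    for a suitable [u] in [U]. *)
Lemma unipotent_of_engel : unipotent g.
Proof.
suff: exists n, forall v, iter n delta v = 0 by [].
apply: contrapT => nU.
have {}nU n : exists v, iter n delta v != 0.
  apply: contrapT => /forallNP E; apply: nU; exists n => v.
  by apply/eqP/negPn/negP; exact: E.
pose A := [set W | L W /\ exists2 w, W w & w != 0].
apply: (@refinement_contradiction A setT) => [W []//||W m AW].
  have [v v0] := nU 0%N; split; last by exists v.
  by case: hL => _ _ [].
have [LW _] := AW.
(* If the image of [delta ^ m] were contained in every nonzero member below [W],
   hence in every nonzero member, the jump at any nonzero vector of that image
   would have bottom zero, so that [delta ^ (m + 1) = 0]. *)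
have [U [AU UW [v nUv]]] :
    exists U, [/\ A U, U `<=` W & exists v, ~ U (iter m delta v)].
  apply: contrapT => nex.
  have sub U v : A U -> U `<=` W -> U (iter m delta v).
    move=> AU UW; apply: contrapT => nUv; apply: nex.
    by exists U; split=> //; exists v.
  have {}sub U v : A U -> U (iter m delta v).
    move=> AU; have [LU _] := AU.
    case: (series_total LU LW) => [|WU]; first exact: sub.
    by apply: WU; exact: sub.
  have [v] := nU m.+1; rewrite iterS => dz; have z0 : iter m delta v != 0.
    by apply: contraNneq dz => ->; rewrite linear0.
  have [B [T [jBT nBz Tz _ _]]] := jump_at z0; have [LB _ _ _] := jBT.
  apply: nBz; apply: sub; split=> //; exists (delta (iter m delta v)) => //.
  exact: delta_jump jBT Tz.
have [LU [w Uw w0]] := AU; have sU := series_subspace LU.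
have [n Un] := unipotent_quotient LU Uw w0.
have [v' v'0] := nU (m + n)%N; pose u := iter n delta v'.
have nPv : ~ plus_kernel U m v by move/(plus_kernel_iter LU).
have [|i [nPi Pi]] := last_iterate _ nPv.
  exact: subspace0 (subspace_sum sU (kernel_subspace m)).
have [f [lf fv fP fU fK]] := plus_kernel_functional LU nPi.
exists U, f, u; split; first by split=> //; exact: Un.
split=> //; exists (iter i delta v).
rewrite iter_ad_rank_one_top ?fv ?scale1r /u -?iterD // => j.
apply: fP; rewrite iterSr -iterS.
by elim: j => [//|j IH]; rewrite iterS; exact: plus_kernel_delta.
Qed.

End StabilityGroup.

Theorem theorem3p4 (F : fieldType) (V : lmodType F) (L : set (set V))
    (hL : is_series L) (g : GL V)
    (hg : hirsch_plotkin (stability_group L) g) :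
  unipotent g.
Proof.
have sS := stability_subgroup hL.
have [N [[_ NS _] _ Ng]] := hirsch_plotkin_single sS hg.
apply: (unipotent_of_engel hL (NS _ Ng)) => x Sx.
exact: hirsch_plotkin_engel sS hg Sx.
Qed.
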